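(* There exists an absolute constant $C>0$ such that for all $m\in\mathbb{N}$, $\eta>0$, $\gamma>0$, $0\le\alpha\le 1$, $s\in\mathbb{N}\cup\{0\}$, $\phi\in C[0,1]$ and $z\in[0,1]$, $$\left|\Re_{m,\eta,\gamma}^{(\alpha,s)}(\phi;z)-\phi(z)\right|\le C\,\omega_2\!\left(\phi;\tfrac12\sqrt{\varphi_{m,\eta,\gamma}^{(\alpha,s)}(z)+\big(\zeta_{m,\eta,\gamma}^{(\alpha,s)}(z)\big)^2}\right)+\omega\!\left(\phi;\big|\zeta_{m,\eta,\gamma}^{(\alpha,s)}(z)\big|\right),$$ where $\zeta_{m,\eta,\gamma}^{(\alpha,s)}(z)=\Re_{m,\eta,\gamma}^{(\alpha,s)}(t-z;z)=\frac{1}{m+1}\frac{\Gamma(\eta+1)\Gamma(\gamma+1)}{\Gamma(\eta+\gamma+1)}-\frac{z}{m+1}$ and $\varphi_{m,\eta,\gamma}^{(\alpha,s)}(z)=\Re_{m,\eta,\gamma}^{(\alpha,s)}((t-z)^2;z)$ are the first and second central moments.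
   Context: $\mathbb{N}$ denotes the positive integers, and $C[0,1]$ the real-valued continuous functions on $[0,1]$. Binomial coefficients are $\binom{a}{b}=\frac{a!}{b!(a-b)!}$ if $0\le b\le a$ and $0$ otherwise; a term whose binomial coefficient is $0$ is understood to be $0$, and $0^0=1$. For $m\in\mathbb{N}$, $0\le j\le m$, $0\le\alpha\le1$, $s\in\mathbb{N}\cup\{0\}$ and $z\in[0,1]$ put: if $m<s$, $$q_{m,j}^{(\alpha,s)}(z)=\binom{m}{j}z^j(1-z)^{m-j};$$ if $m\ge s$, $$q_{m,j}^{(\alpha,s)}(z)=(1-\alpha)\binom{m-s}{j-s}z^{j-s+1}(1-z)^{m-j}+(1-\alpha)\binom{m-s}{j}z^{j}(1-z)^{m-s-j+1}+\alpha\binom{m}{j}z^j(1-z)^{m-j}.$$ For $\eta>0$, $\gamma>0$ and $\phi\in C[0,1]$ define, with $\Gamma$ the Gamma function, $$\Re_{m,\eta,\gamma}^{(\alpha,s)}(\phi;z)=\Gamma(\eta+1)\sum_{j=0}^{m}q_{m,j}^{(\alpha,s)}(z)\int_0^1\frac{(1-t)^{\eta-1}}{\Gamma(\eta)}\,\phi\!\left(\frac{j+t^{\gamma}}{m+1}\right)dt .$$ The notation $\Re_{m,\eta,\gamma}^{(\alpha,s)}((t-z)^k;z)$ means the operator applied to the function $t\mapsto(t-z)^k$ with $z$ fixed, evaluated at $z$. For $\phi\in C[0,1]$ and $\lambda\ge0$: the modulus of continuity is $\omega(\phi;\lambda)=\sup\{|\phi(u+\vartheta)-\phi(u)|:0\le\vartheta\le\lambda,\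 u,u+\vartheta\in[0,1]\}$, and the second-order modulus of smoothness is $\omega_2(\phi;\lambda)=\sup\{|\phi(u+2h)-2\phi(u+h)+\phi(u)|:0\le h\le\lambda,\ u,u+2h\in[0,1]\}$. *)

(* Defs.v *)
(* MathComp-Analysis, over an arbitrary [R : realType]. *)
From mathcomp Require Import all_boot all_order all_algebra.
From mathcomp Require Import all_classical all_reals all_analysis.
Set Implicit Arguments.
Unset Strict Implicit.
Unset Printing Implicit Defensive.
Import Order.TTheory GRing.Theory Num.Theory.
Import numFieldNormedType.Exports.
Local Open Scope classical_set_scope.
Local Open Scope ring_scope.

(* Euler's integral, meaningful for [0 < x]. *)
Definition Gamma (R : realType) (x : R) : R :=
  \int[@lebesgue_measure R]_(t in `]0, +oo[) (t `^ (x - 1) * expR (- t)).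

(* Subtraction on [nat] is truncated, so 'C(m - s, j - s) would be 1 for
   [j < s], where the intended coefficient is 0: hence the explicit test.  In
   the second term [j > m - s] makes 'C(m - s, j) vanish. *)
Definition q_basis (R : realType) (m j : nat) (alpha : R) (s : nat) (z : R) : R :=
  if (m < s)%N then 'C(m, j)%:R * z ^+ j * (1 - z) ^+ (m - j)
  else
    (1 - alpha) * (if (s <= j)%N
                   then 'C(m - s, j - s)%:R * z ^+ (j - s + 1) * (1 - z) ^+ (m - j)
                   else 0)
    + (1 - alpha) * ('C(m - s, j)%:R * z ^+ j * (1 - z) ^+ (m - s - j + 1))
    + alpha * ('C(m, j)%:R * z ^+ j * (1 - z) ^+ (m - j)).

(* An element of C[0,1] is represented by a function [R -> R] continuous on
   [0, 1]; only its values there matter, since (j + t^gamma)/(m + 1) lies in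
   [0, 1].  As [powR] is total, the possible singularity of the integrand at
   [t = 1] is harmless for the Lebesgue integral. *)
Definition frac_op (R : realType) (m : nat) (eta gamma alpha : R) (s : nat)
    (phi : R -> R) (z : R) : R :=
  Gamma (eta + 1) *
  \sum_(j < m.+1) q_basis m j alpha s z *
    \int[@lebesgue_measure R]_(t in `[0, 1])
      ((1 - t) `^ (eta - 1) / Gamma eta * phi ((j%:R + t `^ gamma) / (m%:R + 1))).

Definition central_moment (R : realType) (k m : nat) (eta gamma alpha : R)
    (s : nat) (z : R) : R :=
  frac_op m eta gamma alpha s (fun t => (t - z) ^+ k) z.

Definition omega (R : realType) (phi : R -> R) (lambda : R) : R :=
  sup [set y | exists u v : R,
    [/\ 0 <= v <= lambda, 0 <= u <= 1, 0 <= u + v <= 1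
      & y = `|phi (u + v) - phi u|]].

Definition omega2 (R : realType) (phi : R -> R) (lambda : R) : R :=
  sup [set y | exists u h : R,
    [/\ 0 <= h <= lambda, 0 <= u <= 1, 0 <= u + 2 * h <= 1
      & y = `|phi (u + 2 * h) - 2 * phi (u + h) + phi u|]].

(* Main.v *)
Require Import Defs.
From mathcomp Require Import all_boot all_order all_algebra.
From mathcomp Require Import all_classical all_reals all_analysis.
From mathcomp Require Import measurable_realfun ring lra.
Set Implicit Arguments.
Unset Strict Implicit.
Unset Printing Implicit Defensive.
Import Order.TTheory GRing.Theory Num.Theory.
Import numFieldNormedType.Exports.
Local Open Scope classical_set_scope.
Local Open Scope ring_scope.

(* For fixed parameters and z the operator is a positive linear functional E
   on bounded measurable functions with E 1 = 1.  The formula for its mean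
   [mu = z + zeta] is Euler's relation between Beta and Gamma together with
   sum_j j q_j(z) = m z.

   For the estimate, put [h = lambda / 4] with [lambda] the argument of omega2.
   Interpolating phi linearly at two points [a] and [a + 2h] of [0,1] around
   mu leaves a remainder f that is at most [omega2] in between, and whose
   second differences of step h are at most [omega2]; summing these twice gives
   |f t| <= omega2 * (3 + |t - a| / h)^2 on all of [0,1].  Since
   E ((t - z)^2 + zeta^2) = 4 lambda^2 is comparable to h^2, |E f| and |f mu|
   are both O(omega2).  As E reproduces affine functions,
   E phi - phi mu = E f - f mu, while |phi mu - phi z| is the term in omega. *)

(** * Euler's Beta and Gamma integrals *)

(** Push Lebesgue measure forward along the affine map and scale it by [c]: the result has the right
    value on half-open intervals, hence is Lebesgue measure again by uniqueness. *)
Lemma integral_affine (R : realType) (f : R -> \bar R) (c d : R) : 0 < c ->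
  measurable_fun [set: R] f -> (forall x, (0 <= f x)%E) ->
  (c%:E * \int[@lebesgue_measure R]_x f (c * x + d)%R
   = \int[@lebesgue_measure R]_x f x)%E.
Proof.
move=> c0 mf f0.
pose phi : measurableTypeR R -> measurableTypeR R := fun x => c * x + d.
have mphi : measurable_fun setT phi.
  by apply: measurable_funD => //; exact: measurable_funM.
pose nu : {measure set (measurableTypeR R) -> \bar R} :=
  measure_function_pushforward__canonical__measure_function_Measure lebesgue_measure mphi.
pose mu' : {measure set (measurableTypeR R) -> \bar R} := mscale (NngNum (ltW c0)) nu.
have mu'E (A : set (measurableTypeR R)) : measurable A -> lebesgue_measure A = mu' A.
  apply: lebesgue_measure_unique => X [[a b] /= _ <-].
  rewrite /mu' /mscale/= /pushforward/=.
  have -> : phi @^-1` `]a, b] = `](a - d) / c, (b - d) / c]%classic.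
    apply/seteqP; split => x /=; rewrite !in_itv/= /phi;
    rewrite ltr_pdivrMr// ler_pdivlMr// ltrBlDr lerBrDr ![x * c]mulrC//.
  rewrite !lebesgue_measure_itv/= !lte_fin ltr_pM2r ?invr_gt0// ltrD2r.
  case: ifPn => _; last by rewrite mule0.
  rewrite -EFinD -EFinM; congr EFin.
  by rewrite -mulrBl mulrCA divff ?gt_eqF// mulr1; lra.
rewrite [RHS](@eq_measure_integral _ _ _ setT mu')//; last first.
  by move=> A mA _; exact: mu'E.
rewrite ge0_integral_mscale//=.
by rewrite ge0_integral_pushforward//= preimage_setT.
Qed.

(* Extending x^(a-1) by 0 to the whole line turns Euler's relation into a
   convolution identity, for which only affine changes of variables are
   needed. *)
Definition pospow (R : realType) (a x : R) : R :=
  if 0 < x then x `^ (a - 1) else 0.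

Lemma pospow_ge0 (R : realType) (a x : R) : 0 <= pospow a x.
Proof. by rewrite /pospow; case: ifP => // _; exact: powR_ge0. Qed.

Lemma pospow_gt0E (R : realType) (a x : R) : 0 < x -> pospow a x = x `^ (a - 1).
Proof. by rewrite /pospow => ->. Qed.

Lemma pospow_le0E (R : realType) (a x : R) : x <= 0 -> pospow a x = 0.
Proof. by rewrite /pospow ltNge => ->. Qed.

Lemma measurable_pospow (R : realType) (a : R) :
  measurable_fun [set: R] (pospow a).
Proof.
apply: measurable_fun_ifT; [|exact: measurable_powR|exact: measurable_cst].
exact: measurable_fun_ltr.
Qed.

(** The value is kept in the extended reals so that Tonelli's theorem applies before any finiteness
    is known. *)
Definition egamma (R : realType) (a : R) : \bar R :=
  (\int[@lebesgue_measure R]_x (pospow a x * expR (- x))%:E)%E.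

(** Euler's Beta integral, seen as the value at 1 of the convolution of [pospow a] and
    [pospow b]. *)
Definition ebeta (R : realType) (a b : R) : \bar R :=
  (\int[@lebesgue_measure R]_x (pospow a (1 - x) * pospow b x)%:E)%E.

(** Substituting [x * y] for [y] pulls out the powers of [x] by homogeneity and leaves the
    convolution at 1. *)
Lemma pospow_convolution (R : realType) (a b x : R) : 0 < x ->
  (\int[@lebesgue_measure R]_y (pospow a (x - y)%R * pospow b y)%:E
   = (pospow (a + b) x)%:E * ebeta a b)%E.
Proof.
move=> x0.
pose F (y : R) := (pospow a (x - y) * pospow b y)%:E.
have mF : measurable_fun [set: R] F.
  apply/measurable_EFinP/measurable_funM; last exact: measurable_pospow.
  apply: (measurableT_comp (@measurable_pospow R a)).
  exact: measurable_funB.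
have F0 y : (0 <= F y)%E by rewrite lee_fin mulr_ge0// pospow_ge0.
rewrite -[LHS](integral_affine 0 x0 mF F0) /F.
transitivity (x%:E * \int[@lebesgue_measure R]_y
   ((x `^ (a + b - 2))%:E * (pospow a (1 - y)%R * pospow b y)%:E))%E.
  congr (_ * _)%E; apply: eq_integral => y _.
  rewrite -EFinM; congr EFin; rewrite addr0.
  have -> : x - x * y = x * (1 - y) by ring.
  have [y0|y0] := leP y 0.
    by rewrite (@pospow_le0E R b y)// (@pospow_le0E R b (x * y)) ?mulr0// pmulr_rle0.
  have [y1|y1] := leP (1 - y) 0.
    by rewrite (@pospow_le0E R a (1 - y))// (@pospow_le0E R a (x * _)) ?mul0r ?mulr0// pmulr_rle0.
  rewrite !pospow_gt0E ?mulr_gt0// !powRM ?ltW//.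
  have -> : a + b - 2 = (a - 1) + (b - 1) by ring.
  rewrite (@powRD _ x (a - 1) (b - 1)) ?(gt_eqF x0) ?implybT//; ring.
rewrite ge0_integralZl//; last first.
- by rewrite lee_fin powR_ge0.
- by move=> y _; rewrite lee_fin mulr_ge0// pospow_ge0.
- apply/measurable_EFinP/measurable_funM; last exact: measurable_pospow.
  apply: (measurableT_comp (@measurable_pospow R a)).
  exact: measurable_funB.
rewrite muleA -EFinM pospow_gt0E//; congr ((_%:E) * _)%E.
rewrite -[X in X * _]powRr1 ?ltW// -powRD ?(gt_eqF x0) ?implybT//; congr (_ `^ _); ring.
Qed.

(** The product is a double integral; a translation merges the two exponentials, and after
    exchanging the order of integration the inner integral is the convolution above. *)
Lemma egammaM (R : realType) (a b : R) :
  (egamma a * egamma b = egamma (a + b)%R * ebeta a b)%E.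
Proof.
pose mu := @lebesgue_measure R.
have mexp : measurable_fun [set: R] (fun x : R => expR (- x)).
  by apply: measurableT_comp => //; exact: measurable_oppr.
have mG c : measurable_fun [set: R] (fun x : R => pospow c x * expR (- x)).
  by apply: measurable_funM => //; exact: measurable_pospow.
have mGE c : measurable_fun [set: R] (fun x : R => (pospow c x * expR (- x))%:E).
  exact/measurable_EFinP.
have G0 c x : (0 <= (pospow c x * expR (- x))%:E)%E.
  by rewrite lee_fin mulr_ge0 ?pospow_ge0 ?expR_ge0.
pose F (p : measurableTypeR R * measurableTypeR R) : \bar R :=
  ((pospow a (p.1 - p.2) * pospow b p.2) * expR (- p.1))%:E.
have mF : measurable_fun setT F.
  apply/measurable_EFinP; apply: measurable_funM; last first.
    by apply: (measurableT_comp mexp); exact: measurable_fst.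
  apply: measurable_funM; last first.
    by apply: (measurableT_comp (@measurable_pospow R b)); exact: measurable_snd.
  apply: (measurableT_comp (@measurable_pospow R a)).
  apply: measurable_funB; [exact: measurable_fst|exact: measurable_snd].
have F0 p : (0 <= F p)%E.
  by rewrite lee_fin !mulr_ge0 ?pospow_ge0 ?expR_ge0.
transitivity (\int[mu]_y \int[mu]_x F (x, y))%E.
  rewrite -ge0_integralZl//; [|exact: mGE|exact: integral_ge0].
  apply: eq_integral => y _.
  (* Translating by [y] makes [x] the sum of the two original variables, so that the exponentials
     combine to [expR (- x)]. *)
  rewrite -[X in (X * _)%E](@integral_affine R _ 1 (- y))// mul1e.
  rewrite muleC -ge0_integralZl//; last first.
  - have mT : measurable_fun [set: R] (fun x : R => 1 * x - y).
      apply: measurable_funB; last exact: measurable_cst.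
      by apply: measurable_funM; [exact: measurable_cst|exact: measurable_id].
    exact: (measurableT_comp (mGE a) mT).
  apply: eq_integral => x _; rewrite -EFinM; congr EFin.
  rewrite mul1r mulrACA -expRD /=; congr (_ * expR _); ring.
rewrite -fubini_tonelli//.
transitivity (\int[mu]_x ((pospow (a + b) x * expR (- x))%:E * ebeta a b))%E.
  apply: eq_integral => x _.
  (* For [x <= 0] the two arguments [x - y] and [y] are never both positive, so both sides
     vanish. *)
  have [x0|x0] := leP x 0.
    rewrite (@pospow_le0E R (a + b))// mul0r mul0e.
    apply: integral0_eq => y _; rewrite /F/=.
    have [y0|y0] := leP y 0; first by rewrite (@pospow_le0E R b)// mulr0 mul0r.
    by rewrite (@pospow_le0E R a) ?mul0r// subr_le0 (le_trans x0)// ltW.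
  rewrite mulrC EFinM -muleA -pospow_convolution// -ge0_integralZl//.
  - by apply: eq_integral => y _; rewrite -EFinM /F/= mulrC.
  - apply/measurable_EFinP/measurable_funM; last exact: measurable_pospow.
    apply: (measurableT_comp (@measurable_pospow R a)).
    exact: measurable_funB.
  - by move=> y _; rewrite lee_fin mulr_ge0// pospow_ge0.
rewrite ge0_integralZr//; first exact: mGE.
by apply: integral_ge0 => x _; rewrite lee_fin mulr_ge0// pospow_ge0.
Qed.

(** * Finiteness and positivity of the Gamma integral *)

Lemma integral_powR_itvcc (R : realType) (a e : R) : 0 < a -> 0 < e -> e <= 1 ->
  (\int[@lebesgue_measure R]_(x in `[e, 1%R]) (x `^ (a - 1))%:E
   = ((1 - e `^ a) / a)%:E)%E.
Proof.
move=> a0 e0; rewrite le_eqVlt => /predU1P[->|e1].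
  by rewrite set_itv1 integral_set1 powR1 subrr mul0r.
have gt0 b x : x \in `[e, b] -> 0 < x.
  by rewrite in_itv/= => /andP[+ _]; exact: lt_le_trans.
have dpow c x : 0 < x -> derivable (fun y : R => y `^ c) x 1.
  by move=> x0; apply: derivable_powR; rewrite in_itv/= x0.
have cpow c x : 0 < x -> {for x, continuous (fun y : R => y `^ c)}.
  by move=> x0; apply/differentiable_continuous/derivable1_diffP/dpow.
rewrite (@continuous_FTC2 R _ (fun x => a^-1 * x `^ a))//.
- by rewrite -EFinB powR1; congr EFin; rewrite mulr1 -{1}[a^-1]mulr1 -mulrBr mulrC.
- by apply: derivable_within_continuous => x /gt0; exact: dpow.
- split.
  + move=> x /andP[ex _]; apply: derivableM => //; apply: dpow.
    by rewrite (lt_trans e0).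
  + by apply: cvgMr => //; apply: cvg_at_right_filter; exact: cpow.
  + by apply: cvgMr => //; apply: cvg_at_left_filter; exact: cpow.
- move=> x; rewrite in_itv/= => /andP[ex _].
  have x0 : 0 < x by exact: lt_trans ex.
  rewrite derive1E deriveZ/=; last exact: dpow.
  rewrite -derive1E powR_derive1 ?in_itv/= ?andbT//.
  by rewrite /GRing.scale/= mulrA mulVf ?mul1r// gt_eqF.
Qed.

(** The intervals [1/(n+1), 1] exhaust ]0, 1], and on each of them the integral is at most 1/a;
    monotone convergence concludes. *)
Lemma integral_powR_lty (R : realType) (a : R) : 0 < a ->
  (\int[@lebesgue_measure R]_(x in `]0%R, 1%R]) (x `^ (a - 1))%:E < +oo)%E.
Proof.
move=> a0; apply: (@le_lt_trans _ _ (a^-1)%:E); last exact: ltry.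
rewrite itv_open_bnd_bigcup.
pose F n := `[0 + n.+1%:R^-1 : R, 1]%classic.
have Fpos n x : F n x -> 0 < x.
  by rewrite /F/= in_itv/= add0r => /andP[+ _]; apply: lt_le_trans; rewrite invr_gt0 ltr0n.
have mp : measurable_fun [set: R] (fun x : R => (x `^ (a - 1))%:E).
  by apply/measurable_EFinP; exact: measurable_powR.
have := @ge0_nondecreasing_set_cvg_integral _ (measurableTypeR R) R F
  (fun x : R => (x `^ (a - 1))%:E) (@lebesgue_measure R).
move=> H; apply: (cvge_le _ (H _ _ _ _)).
- near=> n; rewrite /F add0r integral_powR_itvcc// ?invr_gt0// ?invf_le1 ?ler1n//.
  by rewrite lee_fin ler_pdivrMr// mulVf ?gt_eqF// gerBl powR_ge0.
- move=> n m nm; apply/subsetPset => x; rewrite /F/= !in_itv/= => /andP[h ->].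
  rewrite andbT (le_trans _ h)// !add0r lef_pV2 ?posrE ?ltr0n//.
  by rewrite ler_nat.
- by move=> i; exact: measurable_itv.
- by move=> i; exact: measurable_funTS.
- by move=> i x _; rewrite lee_fin powR_ge0.
Unshelve. all: by end_near. Qed.

(** Half of the exponential decay absorbs the power: with n > |a|, the power is at most x^n, and
    x/(2n) <= exp(x/(2n)) raised to the power n gives x^n <= (2n)^n exp(x/2). *)
Lemma powR_expR_le (R : realType) (a : R) : exists2 K : R, 0 <= K &
  forall x, 1 <= x -> x `^ (a - 1) * expR (- x) <= K * expR (- (1 / 2) * x).
Proof.
pose n := Num.bound `|a|.
have an : `|a| < n%:R by exact: archi_boundP.
have n0 : (0 : R) < n%:R by exact: le_lt_trans an.
exists ((2 * n%:R) ^+ n); first by rewrite exprn_ge0// mulr_ge0// ltW.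
move=> x x1.
have -> : - x = - (1 / 2) * x + - (1 / 2) * x by field.
rewrite expRD mulrA ler_pM2r ?expR_gt0//.
have -> : - (1 / 2) * x = - (n%:R * (x / (2 * n%:R))) by field; rewrite gt_eqF.
rewrite expRN ler_pdivrMr ?expR_gt0// mulrC expRM_natl -exprMn.
have x0 : 0 <= x by exact: le_trans x1.
apply: (@le_trans _ _ (x ^+ n)).
  rewrite -powR_mulrn//; apply: ler_powR => //.
  by rewrite lerBlDr (le_trans (ler_norm _))// (le_trans (ltW an))// lerDl.
apply: lerXn2r; rewrite ?nnegrE// ?mulr_ge0 ?expR_ge0// ?(ltW n0)//.
rewrite -ler_pdivrMr ?mulr_gt0//; apply: le_trans (expR_ge1Dx _).
by rewrite lerDr.
Qed.

Lemma measurable_pospow_expR (R : realType) (a : R) :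
  measurable_fun [set: R] (fun x : R => (pospow a x * expR (- x))%:E).
Proof.
apply/measurable_EFinP/measurable_funM; first exact: measurable_pospow.
by apply: measurableT_comp => //; exact: measurable_oppr.
Qed.

(** The integrand is dominated by the bare power on ]0, 1] plus a multiple of the exponential
    density of rate 1/2, which handles the tail. *)
Lemma egamma_lty (R : realType) (a : R) : 0 < a -> (egamma a < +oo)%E.
Proof.
move=> a0; have [K K0 HK] := powR_expR_le a.
pose g : R -> \bar R := (fun x : R => (x `^ (a - 1))%:E) \_ `]0, 1]%classic.
pose h (x : R) : \bar R := ((2 * K)%:E * (exponential_pdf (1 / 2) x)%:E)%E.
have mp : measurable_fun [set: R] (fun x : R => (x `^ (a - 1))%:E).
  by apply/measurable_EFinP; exact: measurable_powR.
have mg : measurable_fun [set: R] g.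
  by apply/(measurable_restrictT _ _).1 => //; exact: measurable_funTS.
have mpdf : measurable_fun [set: R] (fun x : R => (exponential_pdf (1 / 2) x)%:E).
  by apply/measurable_EFinP; exact: measurable_exponential_pdf.
have mh : measurable_fun [set: R] h by exact: measurable_funeM.
have g0 x : (0 <= g x)%E.
  by apply: erestrict_ge0 => y _; rewrite lee_fin powR_ge0.
have p0 (x : R) : 0 <= exponential_pdf (1 / 2) x by apply: exponential_pdf_ge0; rewrite divr_ge0.
have h0 x : (0 <= h x)%E by rewrite mule_ge0// lee_fin ?mulr_ge0.
apply: (@le_lt_trans _ _ (\int[@lebesgue_measure R]_x (g x + h x))%E).
  apply: ge0_le_integral => //.
  - by move=> x _; rewrite lee_fin mulr_ge0 ?pospow_ge0 ?expR_ge0.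
  - exact: measurable_pospow_expR.
  - exact: emeasurable_funD.
  move=> x _; have [x0|x0] := leP x 0.
    by rewrite pospow_le0E// mul0r adde_ge0.
  rewrite pospow_gt0E//; have [x1|x1] := leP x 1.
    rewrite -[leLHS]adde0 leeD// /g patchE mem_set/= ?in_itv/= ?x0//.
    by rewrite lee_fin ler_piMr ?powR_ge0// -expR0 ler_expR oppr_le0 ltW.
  rewrite -[leLHS]add0e leeD// lee_fin.
  rewrite exponential_pdfE ?(ltW x0)// mulrA.
  have -> : 2 * K * (1 / 2) = K by field.
  by apply: HK; exact: ltW.
rewrite ge0_integralD//= ge0_integralZl//=; last 2 first.
- by move=> x _; rewrite lee_fin.
- by rewrite lee_fin mulr_ge0.
rewrite integral_exponential_pdf// mule1 lte_add_pinfty ?ltry//.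
by rewrite -integral_mkcond; exact: integral_powR_lty.
Qed.

(** A zero integral would make the integrand vanish almost everywhere, but it is positive on ]0, 1],
    a set of measure 1. *)
Lemma egamma_gt0 (R : realType) (a : R) : (0 < egamma a)%E.
Proof.
have ge0 : (0 <= egamma a)%E.
  by apply: integral_ge0 => x _; rewrite lee_fin mulr_ge0 ?pospow_ge0 ?expR_ge0.
rewrite lt0e ge0 andbT; apply/eqP => eg0.
have [N [mN N0 Nsub]] : ae_eq (@lebesgue_measure R) setT
    (fun x => (pospow a x * expR (- x))%:E) (cst 0%E).
  apply/(ae_eq_integral_abs _ measurableT); first exact: measurable_pospow_expR.
  rewrite -[RHS]eg0; apply: eq_integral => x _.
  by rewrite gee0_abs// lee_fin mulr_ge0 ?pospow_ge0 ?expR_ge0.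
have : (@lebesgue_measure R `]0%R, 1%R] <= lebesgue_measure N)%E.
  apply: le_measure; rewrite ?inE//.
  move=> x/=; rewrite in_itv/= => /andP[x0 _]; apply: Nsub => /(_ I) /= /eqP.
  by rewrite eqe pospow_gt0E// gt_eqF// mulr_gt0 ?powR_gt0 ?expR_gt0.
by rewrite N0 lebesgue_measure_itv/= lte_fin ltr01 oppr0 adde0 lee_fin ler10.
Qed.

Lemma egamma1 (R : realType) : egamma 1 = 1%E :> \bar R.
Proof.
rewrite -[RHS](@integral_exponential_pdf R 1)// /egamma.
(* The integrand agrees with the exponential density of rate 1 except at 0, where [pospow] is 0 and
   the density is 1; that point is removed on both sides. *)
rewrite -(@integral_setD1 _ _ 0 setT).
rewrite -[RHS](@integral_setD1 _ _ 0 setT).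
apply: eq_integral => x; rewrite inE/= => -[_ /eqP x0].
have [xlt0|xgt0|x00] := ltgtP x 0.
- by rewrite pospow_le0E ?ltW// mul0r lt0_exponential_pdf.
- by rewrite pospow_gt0E// subrr powRr0 exponential_pdfE ?ltW// !mul1r mulN1r.
- by rewrite x00 eqxx in x0.
- exact: measurableD.
- by apply/measurable_funTS/measurable_EFinP; exact: measurable_exponential_pdf.
- exact: measurableD.
- by apply/measurable_funTS; exact: measurable_pospow_expR.
Qed.

Lemma GammaE (R : realType) (a : R) : Gamma a = fine (egamma a).
Proof.
rewrite /Gamma /Rintegral /egamma integral_mkcond; congr fine.
apply: eq_integral => x _; rewrite patchE.
have [x0|x0] := leP x 0.
  by rewrite pospow_le0E// mul0r memNset//= in_itv/= andbT; apply/negP; rewrite -leNgt.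
by rewrite pospow_gt0E// mem_set//= in_itv/= x0.
Qed.

Lemma ebeta_ge0 (R : realType) (a b : R) : (0 <= ebeta a b)%E.
Proof. by apply: integral_ge0 => x _; rewrite lee_fin mulr_ge0// pospow_ge0. Qed.

(** An infinite value would make the right-hand side of [egammaM] infinite, while its left-hand side
    is finite. *)
Lemma ebeta_fin_num (R : realType) (a b : R) : 0 < a -> 0 < b ->
  ebeta a b \is a fin_num.
Proof.
move=> a0 b0; rewrite ge0_fin_numE ?ebeta_ge0// ltNge leye_eq; apply/eqP => bE.
have : (egamma a * egamma b < +oo)%E.
  rewrite lte_mul_pinfty ?egamma_lty ?(ltW (egamma_gt0 a))//.
  by rewrite ge0_fin_numE ?egamma_lty// ltW// egamma_gt0.
by rewrite egammaM bE gt0_muley ?egamma_gt0.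
Qed.

Lemma egamma_fin_num (R : realType) (a : R) : 0 < a -> egamma a \is a fin_num.
Proof. by move=> a0; rewrite ge0_fin_numE ?egamma_lty// ltW// egamma_gt0. Qed.

Lemma Gamma_gt0 (R : realType) (a : R) : 0 < a -> 0 < Gamma a.
Proof. by move=> a0; rewrite GammaE fine_gt0// egamma_gt0 egamma_lty. Qed.

Lemma Gamma1 (R : realType) : Gamma 1 = 1 :> R.
Proof. by rewrite GammaE egamma1. Qed.

Lemma GammaM (R : realType) (a b : R) : 0 < a -> 0 < b ->
  Gamma a * Gamma b = Gamma (a + b) * fine (ebeta a b).
Proof.
move=> a0 b0; rewrite !GammaE -fineM ?egamma_fin_num// egammaM.
by rewrite fineM ?ebeta_fin_num ?egamma_fin_num ?addr_gt0.
Qed.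

Lemma measurable_powR_onem (R : realType) (c : R) :
  measurable_fun [set: R] (fun t : R => (1 - t) `^ c).
Proof.
have mB : measurable_fun [set: R] (fun t : R => 1 - t) by exact: measurable_funB.
exact: (measurableT_comp (measurable_powR c) mB).
Qed.

Lemma ebetaE (R : realType) (a b : R) :
  (\int[@lebesgue_measure R]_(t in `[0%R, 1%R]) ((1 - t) `^ (a - 1) * t `^ (b - 1))%:E
   = ebeta a b)%E.
Proof.
have mf D : measurable_fun D (fun t : R => ((1 - t) `^ (a - 1) * t `^ (b - 1))%:E).
  apply: measurable_funTS; apply/measurable_EFinP/measurable_funM; last exact: measurable_powR.
  exact: measurable_powR_onem.
(* At the endpoints [powR] may be 1 (zero to the power zero) where [pospow] is 0, so both endpoints
   are discarded first. *)
rewrite -integral_itv_bndo_bndc// -integral_itv_obnd_cbnd// integral_mkcond.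
apply: eq_integral => t _; rewrite patchE.
have [t0|t0] := leP t 0.
  rewrite (pospow_le0E b)// mulr0 memNset//= in_itv/= => /andP[].
  by rewrite ltNge t0.
have [t1|t1] := leP 1 t.
  rewrite pospow_le0E ?subr_le0// mul0r memNset//= in_itv/= => /andP[_].
  by rewrite ltNge t1.
by rewrite !pospow_gt0E ?subr_gt0// mem_set//= in_itv/= t0 t1.
Qed.

(** * Averages against a Beta density on [0, 1] *)

Section beta_mean.
Context (R : realType) (eta : R).
Hypothesis eta_gt0 : 0 < eta.

(** A class closed under sums and products and integrable against the kernel, whatever its
    singularity at 1. *)
Definition bounded_measurable01 (f : R -> R) :=
  measurable_fun (`[0, 1] : set R) f /\ exists M : R, forall t : R, 0 <= t <= 1 -> `|f t| <= M.

Definition beta_weight (t : R) : R := (1 - t) `^ (eta - 1) / Gamma eta.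

(** The factor in front turns the kernel into the probability density eta (1-t)^(eta-1), that of the
    Beta law with parameters 1 and eta. *)
Definition beta_mean (f : R -> R) : R :=
  Gamma (eta + 1) * \int[@lebesgue_measure R]_(t in `[0, 1]) (beta_weight t * f t).

Lemma beta_weight_ge0 t : 0 <= beta_weight t.
Proof. by rewrite divr_ge0 ?powR_ge0// ltW// Gamma_gt0. Qed.

Lemma measurable_beta_weight : measurable_fun [set: R] beta_weight.
Proof.
apply: measurable_funM; last exact: measurable_cst.
exact: measurable_powR_onem.
Qed.

Lemma integral_beta_weight_powR (b : R) : 0 < b ->
  (\int[@lebesgue_measure R]_(t in `[0%R, 1%R]) (beta_weight t * t `^ (b - 1))%:E
   = (Gamma b / Gamma (eta + b)%R)%:E)%E.
Proof.
move=> b0; have G0 := Gamma_gt0 eta_gt0.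
have G1 : 0 < Gamma (eta + b) by rewrite Gamma_gt0// addr_gt0.
transitivity ((Gamma eta)^-1%:E * ebeta eta b)%E.
  rewrite -ebetaE -ge0_integralZl//.
  - by apply: eq_integral => t _; rewrite -EFinM /beta_weight mulrAC mulrC.
  - apply: measurable_funTS; apply/measurable_EFinP/measurable_funM; last exact: measurable_powR.
    exact: measurable_powR_onem.
  - by move=> t _; rewrite lee_fin mulr_ge0 ?powR_ge0.
  - by rewrite lee_fin invr_ge0 (ltW G0).
rewrite -[ebeta _ _]fineK ?ebeta_fin_num// -EFinM; congr EFin.
move: (GammaM eta_gt0 b0) G0 G1.
move: (Gamma eta) (Gamma b) (Gamma (eta + b)) (fine _) => A B C D h A0 C0.
apply: (mulfI (lt0r_neq0 A0)).
by rewrite mulVKf ?(gt_eqF A0)// mulrA h mulrAC mulfV ?(gt_eqF C0)// mul1r.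
Qed.

Lemma integrable_beta_weight f : bounded_measurable01 f ->
  (@lebesgue_measure R).-integrable `[0%R, 1%R] (fun t => (beta_weight t * f t)%:E).
Proof.
move=> [mf [M fM]].
have mw D : measurable_fun D (fun t => (beta_weight t)%:E).
  by apply: measurable_funTS; apply/measurable_EFinP; exact: measurable_beta_weight.
have iw : (@lebesgue_measure R).-integrable `[0%R, 1%R] (fun t => (beta_weight t)%:E).
  apply/integrableP; split; first exact: mw.
  (* The mass of the kernel is the Beta integral with [b = 1], because [powR] with exponent 0 is 1
     even at [t = 0]. *)
  apply: (@le_lt_trans _ _
    (\int[@lebesgue_measure R]_(t in `[0%R, 1%R]) (beta_weight t * t `^ (1 - 1))%:E)%E); last first.
    by rewrite integral_beta_weight_powR// ltry.
  rewrite le_eqVlt; apply/orP; left; apply/eqP; apply: eq_integral => t _.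
  by rewrite subrr powRr0 mulr1 gee0_abs// lee_fin beta_weight_ge0.
apply: (@le_integrable _ _ _ lebesgue_measure _ _ _ (fun t => M%:E * (beta_weight t)%:E)%E) => //.
- apply/measurable_EFinP/measurable_funM => //.
  by apply: measurable_funTS; exact: measurable_beta_weight.
- move=> t /=; rewrite in_itv/= => t01; rewrite lee_fin !normrM mulrC.
  by rewrite ler_wpM2r// (le_trans (fM _ t01))// ler_norm.
- exact: integrableZl.
Qed.

Lemma beta_meanD f g : bounded_measurable01 f -> bounded_measurable01 g ->
  beta_mean (fun t => f t + g t) = beta_mean f + beta_mean g.
Proof.
move=> bf bg; rewrite /beta_mean -mulrDr -RintegralD//; last 2 first.
- exact: integrable_beta_weight.
- exact: integrable_beta_weight.
by congr (_ * _); apply: eq_Rintegral => t _; rewrite mulrDr.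
Qed.

Lemma beta_meanZ c f : bounded_measurable01 f ->
  beta_mean (fun t => c * f t) = c * beta_mean f.
Proof.
move=> bf; rewrite /beta_mean [RHS]mulrCA; congr (_ * _).
rewrite -RintegralZl//; last exact: integrable_beta_weight.
by apply: eq_Rintegral => t _; rewrite mulrCA.
Qed.

Lemma le_beta_mean f g : bounded_measurable01 f -> bounded_measurable01 g ->
  (forall t, 0 <= t <= 1 -> f t <= g t) -> beta_mean f <= beta_mean g.
Proof.
move=> bf bg fg; apply: ler_wpM2l; first by rewrite ltW// Gamma_gt0// addr_gt0.
apply: le_Rintegral => //; try exact: integrable_beta_weight.
move=> t /=; rewrite in_itv/= => t01.
by rewrite ler_wpM2l ?beta_weight_ge0// fg.
Qed.

Lemma beta_mean_powR gamma : 0 < gamma ->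
  beta_mean (fun t => t `^ gamma)
  = Gamma (eta + 1) * Gamma (gamma + 1) / Gamma (eta + gamma + 1).
Proof.
move=> g0; rewrite /beta_mean -mulrA; congr (_ * _).
have := @integral_beta_weight_powR (gamma + 1); rewrite addr_gt0// => /(_ isT).
by rewrite addrK addrA /Rintegral => ->.
Qed.

Lemma beta_mean_cst c : beta_mean (fun=> c) = c.
Proof.
have b1 : bounded_measurable01 (fun=> 1).
  by split; [exact: measurable_cst|exists 1 => t _; rewrite normr1].
have -> : (fun=> c) = (fun t : R => c * 1) by apply/funext => t; rewrite mulr1.
rewrite beta_meanZ// -[RHS]mulr1; congr (_ * _).
rewrite /beta_mean.
have -> : \int[@lebesgue_measure R]_(t in `[0, 1]) (beta_weight t * 1)
    = \int[@lebesgue_measure R]_(t in `[0, 1]) (beta_weight t * t `^ (1 - 1)).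
  by apply: eq_Rintegral => t _; rewrite subrr powRr0.
rewrite /Rintegral integral_beta_weight_powR//= Gamma1 mul1r divff//.
by rewrite gt_eqF// Gamma_gt0// addr_gt0.
Qed.

End beta_mean.

(** * The operator as a positive functional *)

Definition bernstein (R : realType) (n j : nat) (z : R) : R :=
  'C(n, j)%:R * z ^+ j * (1 - z) ^+ (n - j).

Lemma sum_bernstein (R : realType) (n : nat) (z : R) :
  \sum_(0 <= j < n.+1) bernstein n j z = 1.
Proof.
rewrite big_mkord -[RHS](expr1n _ n) -[1](subrK z) exprDn.
by apply: eq_bigr => j _; rewrite /bernstein -mulrA mulr_natl mulrC.
Qed.

(** The absorption identity for binomial coefficients lowers the degree by one and reduces the mean
    to the total mass. *)
Lemma sum_bernstein_natr (R : realType) (n : nat) (z : R) :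
  \sum_(0 <= j < n.+1) bernstein n j z * j%:R = n%:R * z.
Proof.
case: n => [|n]; first by rewrite big_nat1 mulr0 mul0r.
rewrite big_nat_recl// mulr0 add0r.
rewrite -[RHS]mulr1 -[X in _ = _ * X](sum_bernstein n z) mulr_sumr; apply: eq_bigr => j _.
rewrite /bernstein subSS exprS.
have : n.+1%:R * 'C(n, j)%:R = j.+1%:R * 'C(n.+1, j.+1)%:R :> R.
  by rewrite -!natrM mul_bin_diag.
set A := n.+1%:R; set B := 'C(n, j)%:R; set C := j.+1%:R; set D := 'C(_, _)%:R.
set X := z ^+ j; set Y := (1 - z) ^+ _ => h.
transitivity (C * D * z * X * Y); first by ring.
by rewrite -h; ring.
Qed.

(** The basis is a mixture of binomial laws: with weight [alpha] of degree [m], otherwise of degree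
    [m - s] with the index shifted by [s] with probability [z]. Mass and mean can be read off this
    form. *)
Lemma sum_q_basis_mul (R : realType) (m s : nat) (alpha z : R) (g : nat -> R) :
  (s <= m)%N ->
  \sum_(j < m.+1) q_basis m j alpha s z * g j
  = (1 - alpha) * (z * \sum_(0 <= i < (m - s).+1) bernstein (m - s) i z * g (i + s)%N
      + (1 - z) * \sum_(0 <= i < (m - s).+1) bernstein (m - s) i z * g i)
    + alpha * \sum_(0 <= j < m.+1) bernstein m j z * g j.
Proof.
move=> sm; rewrite -(big_mkord xpredT (fun j => q_basis m j alpha s z * g j)).
pose A j := if (s <= j)%N
  then 'C(m - s, j - s)%:R * z ^+ (j - s + 1) * (1 - z) ^+ (m - j) else 0.
pose B j := 'C(m - s, j)%:R * z ^+ j * (1 - z) ^+ (m - s - j + 1).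
have -> : \sum_(0 <= j < m.+1) q_basis m j alpha s z * g j =
    \sum_(0 <= j < m.+1) ((1 - alpha) * (A j * g j) + (1 - alpha) * (B j * g j)
       + alpha * (bernstein m j z * g j)).
  by apply: eq_bigr => j _; rewrite /q_basis ltnNge sm /= -/(A j) -/(B j) /bernstein; ring.
rewrite !big_split/= -!mulr_sumr mulrDr; congr (_ * _ + _ * _ + _).
- rewrite (@big_cat_nat _ _ _ s)//=; last exact: leq_trans sm _.
  rewrite big_nat_cond big1 ?add0r; last first.
    by move=> j /andP[/andP[_ js] _]; rewrite /A leqNgt js mul0r.
  rewrite -{1}[s]add0n big_addn subSn// mulr_sumr.
  apply: eq_big_nat => i /andP[_ im].
  rewrite /A leq_addl addnK /bernstein addn1 exprS.
  have -> : (m - (i + s) = m - s - i)%N by rewrite addnC subnDA.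
  by ring.
(* Indices beyond [m - s], where the subtraction in the exponent would be truncated, carry a zero
   binomial coefficient. *)
- rewrite (@big_cat_nat _ _ _ (m - s).+1)//=; last by rewrite ltnS leq_subr.
  rewrite [X in _ + X]big_nat_cond [X in _ + X]big1 ?addr0; last first.
    by move=> j /andP[/andP[js _] _]; rewrite /B bin_small// !mul0r.
  rewrite mulr_sumr; apply: eq_big_nat => i _.
  by rewrite /B /bernstein addn1 exprS; ring.
Qed.

Lemma sum_q_basis (R : realType) (m s : nat) (alpha z : R) :
  \sum_(j < m.+1) q_basis m j alpha s z = 1.
Proof.
have [sm|ms] := leqP s m; last first.
  rewrite -(sum_bernstein m z) big_mkord; apply: eq_bigr => j _.
  by rewrite /q_basis ms.
under eq_bigr do rewrite -[q_basis _ _ _ _ _]mulr1.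
rewrite (@sum_q_basis_mul R m s alpha z (fun=> 1))// -!mulr_suml !sum_bernstein.
by ring.
Qed.

(** The shift by [s] with probability [z] adds [s z] to the mean [(m - s) z], so both components of
    the mixture have mean [m z]. *)
Lemma sum_q_basis_natr (R : realType) (m s : nat) (alpha z : R) :
  \sum_(j < m.+1) q_basis m j alpha s z * j%:R = m%:R * z.
Proof.
have [sm|ms] := leqP s m; last first.
  rewrite -sum_bernstein_natr big_mkord; apply: eq_bigr => j _.
  by rewrite /q_basis ms.
rewrite (@sum_q_basis_mul R m s alpha z (fun j => j%:R))// !sum_bernstein_natr.
under eq_bigr do rewrite natrD mulrDr.
rewrite big_split/= -mulr_suml sum_bernstein sum_bernstein_natr natrB//.
by ring.
Qed.

Lemma q_basis_ge0 (R : realType) (m j s : nat) (alpha z : R) :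
  0 <= alpha <= 1 -> 0 <= z <= 1 -> 0 <= q_basis m j alpha s z.
Proof.
move=> /andP[a0 a1] /andP[z0 z1].
have u0 : 0 <= 1 - z by rewrite subr_ge0.
have b0 : 0 <= 1 - alpha by rewrite subr_ge0.
rewrite /q_basis; case: ifP => _; last case: ifP => _;
  by rewrite ?addr_ge0 ?mulr_ge0 ?exprn_ge0.
Qed.

Lemma powR_le1 (R : realType) (r t : R) : 0 <= r -> 0 <= t <= 1 -> t `^ r <= 1.
Proof.
move=> r0 /andP[t0 t1].
have -> : 1 = 1 `^ r :> R by rewrite powR1.
by rewrite ge0_ler_powR ?nnegrE.
Qed.

Section frac_op_functional.
Context (R : realType) (m s : nat) (eta gamma alpha z : R).
Hypotheses (eta0 : 0 < eta) (gamma0 : 0 < gamma) (alpha01 : 0 <= alpha <= 1)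
  (z01 : 0 <= z <= 1).

Let E phi := frac_op m eta gamma alpha s phi z.
Let node (j : nat) (t : R) := (j%:R + t `^ gamma) / (m%:R + 1).

(** This form, a combination of Beta averages, lets linearity and positivity pass from [beta_mean]
    to the operator. *)
Lemma frac_opE phi :
  E phi = \sum_(j < m.+1) q_basis m j alpha s z * beta_mean eta (phi \o node j).
Proof. by rewrite /E /frac_op mulr_sumr; apply: eq_bigr => j _; rewrite mulrCA. Qed.

Lemma node01 j t : (j <= m)%N -> 0 <= t <= 1 -> 0 <= node j t <= 1.
Proof.
move=> jm /andP[t0 t1]; have m0 : 0 < m%:R + 1 :> R by rewrite ltr_wpDl.
rewrite divr_ge0 ?addr_ge0 ?powR_ge0 ?(ltW m0)//= ler_pdivrMr// mul1r.
by rewrite lerD ?ler_nat// powR_le1// ?t0// ltW.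
Qed.

Lemma bounded_measurable01_node phi j : (j <= m)%N ->
  bounded_measurable01 phi -> bounded_measurable01 (phi \o node j).
Proof.
move=> jm [mphi [M hM]]; split; last first.
  by exists M => t t01; apply: hM; exact: node01.
apply: (measurable_comp _ _ mphi) => //.
- move=> _ [t /= + <-]; rewrite !in_itv/= => t01; exact: node01.
- apply: measurable_funTS; apply: measurable_funM; last exact: measurable_cst.
  by apply: measurable_funD; [exact: measurable_cst|exact: measurable_powR].
Qed.

Lemma frac_opD f g : bounded_measurable01 f -> bounded_measurable01 g ->
  E (fun t => f t + g t) = E f + E g.
Proof.
move=> bf bg; rewrite !frac_opE -big_split/=; apply: eq_bigr => j _.
have jm : (j <= m)%N by rewrite -ltnS.
by rewrite -mulrDr -beta_meanD//; exact: bounded_measurable01_node.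
Qed.

Lemma frac_opZ c f : bounded_measurable01 f ->
  E (fun t => c * f t) = c * E f.
Proof.
move=> bf; rewrite !frac_opE mulr_sumr; apply: eq_bigr => j _.
have jm : (j <= m)%N by rewrite -ltnS.
rewrite [RHS]mulrCA; congr (_ * _).
by rewrite -beta_meanZ//; exact: bounded_measurable01_node.
Qed.

Lemma le_frac_op f g : bounded_measurable01 f -> bounded_measurable01 g ->
  (forall t, 0 <= t <= 1 -> f t <= g t) -> E f <= E g.
Proof.
move=> bf bg fg; rewrite !frac_opE; apply: ler_sum => j _.
have jm : (j <= m)%N by rewrite -ltnS.
rewrite ler_wpM2l ?q_basis_ge0//.
apply: le_beta_mean => //; try exact: bounded_measurable01_node.
by move=> t t01; apply: fg; exact: node01.
Qed.

Lemma frac_op_cst c : E (fun=> c) = c.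
Proof.
rewrite frac_opE -[RHS]mul1r -(sum_q_basis m s alpha z) mulr_suml.
by apply: eq_bigr => j _; rewrite beta_mean_cst.
Qed.

Lemma bounded_measurable01_cst c : bounded_measurable01 (fun=> c : R).
Proof. by split; [exact: measurable_cst|exists `|c|]. Qed.

(** The average of [node j] is [(j + G) / (m + 1)] with [G] the Gamma quotient, and the basis has
    mass 1 and mean [m z]. *)
Lemma frac_op_id : E id = (m%:R * z
  + Gamma (eta + 1) * Gamma (gamma + 1) / Gamma (eta + gamma + 1)) / (m%:R + 1).
Proof.
set G := (X in (_ + X) / _).
have bp : bounded_measurable01 (fun t : R => t `^ gamma).
  split; first by apply: measurable_funTS; exact: measurable_powR.
  by exists 1 => t t01; rewrite ger0_norm ?powR_ge0// powR_le1// ltW.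
have node_mean j : beta_mean eta (node j) = (m%:R + 1)^-1 * (j%:R + G).
  rewrite /G -beta_mean_powR// -{1}(beta_mean_cst eta0 j%:R).
  rewrite -beta_meanD//; last exact: bounded_measurable01_cst.
  rewrite -beta_meanZ//; first by congr beta_mean; apply/funext => t; rewrite mulrC.
  split.
    apply: measurable_funTS; apply: measurable_funD; [exact: measurable_cst|].
    exact: measurable_powR.
  exists (j%:R + 1) => t t01.
  by rewrite ger0_norm ?addr_ge0 ?powR_ge0// lerD2l powR_le1// ltW.
rewrite frac_opE.
under eq_bigr => j _ do rewrite (_ : id \o node j = node j)// node_mean mulrCA mulrDr.
by rewrite -mulr_sumr big_split/= sum_q_basis_natr -mulr_suml sum_q_basis mul1r mulrC.
Qed.

End frac_op_functional.

(** * Approximation by an affine function *)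

(** First differences start below [2 W] and gain at most [W] per step; summing them gives quadratic
    growth. *)
Lemma second_difference_growth (R : realType) (a : nat -> R) (W : R) (k : nat) :
  `|a 0| <= W -> `|a 1| <= W ->
  (forall i, (i.+2 <= k)%N -> `|a i.+2 - 2 * a i.+1 + a i| <= W) ->
  `|a k| <= W * (1 + k%:R) ^+ 2.
Proof.
move=> a0 a1 H; have W0 : 0 <= W by exact: le_trans a0.
have d i : (i < k)%N -> `|a i.+1 - a i| <= (2 + i%:R) * W.
  elim: i => [|i IH] ik.
    by rewrite addr0 mulr_natl mulr2n (le_trans (ler_normB _ _))// lerD.
  have -> : a i.+2 - a i.+1 = (a i.+2 - 2 * a i.+1 + a i) + (a i.+1 - a i) by ring.
  rewrite (le_trans (ler_normD _ _))//.
  have -> : (2 + i.+1%:R) * W = W + (2 + i%:R) * W by rewrite -(natr1 i); ring.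
  by rewrite lerD ?H// IH// ltnW.
suff : forall i, (i <= k)%N -> `|a i| <= W * (1 + i%:R) ^+ 2 by apply.
elim=> [|i IH] ik; first by rewrite addr0 expr1n mulr1.
have -> : a i.+1 = (a i.+1 - a i) + a i by ring.
rewrite (le_trans (ler_normD _ _))// (le_trans (lerD (d _ ik) (IH (ltnW ik))))//.
rewrite -subr_ge0 -(natr1 i).
have -> : W * (1 + (i%:R + 1)) ^+ 2 - ((2 + i%:R) * W + W * (1 + i%:R) ^+ 2)
   = W * (1 + i%:R) by ring.
by rewrite mulr_ge0.
Qed.

(* If [S] is the supremum of [|f|], a second difference with one foot at the
   nearer zero of [f] gives [2 |f x| <= W + S], hence [S <= (W + S) / 2]. *)
Lemma chord_bound (R : realType) (f : R -> R) (a b M W : R) : a <= b ->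
  (forall x, a <= x <= b -> `|f x| <= M) ->
  f a = 0 -> f b = 0 ->
  (forall u h, 0 <= h -> a <= u -> u + 2 * h <= b ->
    `|f (u + 2 * h) - 2 * f (u + h) + f u| <= W) ->
  forall x, a <= x <= b -> `|f x| <= W.
Proof.
move=> ab fM fa fb H.
pose A := [set y | exists2 x, a <= x <= b & y = `|f x|].
have A0 : A !=set0 by exists `|f a|, a; rewrite ?lexx.
have Aub : has_ubound A by exists M => _ [x xab ->]; exact: fM.
have le_S x : a <= x <= b -> `|f x| <= sup A.
  by move=> xab; apply: ub_le_sup => //; exists x.
have half x : a <= x <= b -> 2 * `|f x| <= W + sup A.
  move=> /andP[ax xb]; rewrite -{1}[2]ger0_norm// -normrM.
  have [xm|mx] := leP (2 * x) (a + b).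
    have := H a (x - a); rewrite subr_ge0 ax lexx fa addr0.
    have -> : a + 2 * (x - a) = 2 * x - a by ring.
    have -> : a + (x - a) = x by ring.
    move=> /(_ isT isT) /= h.
    have xb' : 2 * x - a <= b by lra.
    have -> : 2 * f x = - (f (2 * x - a) - 2 * f x) + f (2 * x - a) by ring.
    rewrite (le_trans (ler_normD _ _))// normrN lerD ?h// le_S//.
    by apply/andP; split=> //; lra.
  have := H (2 * x - b) (b - x); rewrite subr_ge0 xb.
  have -> : 2 * x - b + 2 * (b - x) = b by ring.
  have -> : 2 * x - b + (b - x) = x by ring.
  have ax' : a <= 2 * x - b by lra.
  rewrite ax' lexx fb sub0r => /(_ isT isT isT) h.
  have -> : 2 * f x = - (- (2 * f x) + f (2 * x - b)) + f (2 * x - b) by ring.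
  rewrite (le_trans (ler_normD _ _))// normrN lerD ?h// le_S//.
  by apply/andP; split=> //; lra.
have : sup A <= (W + sup A) / 2.
  by apply: ge_sup => // _ [x xab ->]; rewrite ler_pdivlMr// mulrC half.
by move=> SW x xab; have := le_S x xab; lra.
Qed.

(** Subtracting the chord over [[a, a + 2h]] leaves second differences unchanged. The remainder is
    at most [W] there by [chord_bound], and a walk of step [h] from two nodes in that interval
    reaches any other point. *)
Lemma affine_approximation (R : realType) (phi : R -> R) (a h M W : R) :
  0 < h -> 0 <= a -> a + 2 * h <= 1 ->
  (forall t, 0 <= t <= 1 -> `|phi t| <= M) ->
  (forall u v, 0 <= v <= h -> 0 <= u -> u + 2 * v <= 1 ->
    `|phi (u + 2 * v) - 2 * phi (u + v) + phi u| <= W) ->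
  exists c d, forall t, 0 <= t <= 1 ->
    `|phi t - (c + d * t)| <= W * (3 + `|t - a| / h) ^+ 2.
Proof.
move=> h0 a0 ah phiM H.
pose d := (phi (a + 2 * h) - phi a) / (2 * h); pose c := phi a - d * a.
exists c, d.
pose f t := phi t - (c + d * t).
have f2E u v : f (u + 2 * v) - 2 * f (u + v) + f u
    = phi (u + 2 * v) - 2 * phi (u + v) + phi u by rewrite /f; ring.
have H' u v : 0 <= v <= h -> 0 <= u -> u + 2 * v <= 1 ->
    `|f (u + 2 * v) - 2 * f (u + v) + f u| <= W by rewrite f2E; exact: H.
have W0 : 0 <= W.
  have := H 0 0; rewrite lexx (ltW h0) mulr0 !addr0 ler01 => /(_ isT isT isT).
  exact: le_trans.
have fW x : a <= x <= a + 2 * h -> `|f x| <= W.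
  (* This crude bound only makes the supremum in [chord_bound] finite; it does not enter the
     estimate. *)
  apply: (@chord_bound R f _ _ (M + (`|c| + `|d|))).
  - lra.
  - move=> {}x /andP[ax xb].
    have x01 : 0 <= x <= 1 by apply/andP; split; lra.
    rewrite (le_trans (ler_normB _ _))// lerD ?phiM// (le_trans (ler_normD _ _))//.
    rewrite lerD2l normrM ler_piMr// ger0_norm; lra.
  - by rewrite /f /c; ring.
  - by rewrite /f /c /d; field; rewrite gt_eqF.
  - by move=> u v v0 au uv; apply: H'; [apply/andP; split|..]; lra.
move=> t /andP[t0 t1]; rewrite -/(f t).
have [at_|ta] := leP a t.
  (* The walk to the right starts at [t - k h], in [[a, a + h[], so its first two nodes lie in
     [[a, a + 2h]]. *)
  pose k := Num.truncn ((t - a) / h).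
  have /andP[k1 k2] : k%:R <= (t - a) / h < k.+1%:R.
    by rewrite truncn_itv// divr_ge0// ?subr_ge0// ltW.
  rewrite ler_pdivlMr// in k1; rewrite ltr_pdivrMr// -natr1 mulrDl mul1r in k2.
  pose g i := f (t - k%:R * h + i%:R * h).
  have -> : f t = g k by rewrite /g subrK.
  apply: (@le_trans _ _ (W * (1 + k%:R) ^+ 2)).
    apply: second_difference_growth.
    - by rewrite /g mul0r addr0; apply: fW; apply/andP; split; lra.
    - by rewrite /g mul1r; apply: fW; apply/andP; split; lra.
    move=> i ik; rewrite /g -(natr1 i.+1) -(natr1 i).
    set x := t - k%:R * h + i%:R * h.
    have -> : t - k%:R * h + (i%:R + 1 + 1) * h = x + 2 * h by rewrite /x; ring.
    have -> : t - k%:R * h + (i%:R + 1) * h = x + h by rewrite /x; ring.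
    have ik' : (i%:R + 2) * h <= k%:R * h :> R.
      by rewrite ler_pM2r// -[2]/(2%:R) -natrD ler_nat addn2.
    have i0 : 0 <= i%:R * h by rewrite mulr_ge0// ltW.
    by apply: H'; rewrite /x; [apply/andP; split|..]; lra.
  rewrite ler_wpM2l// lerXn2r// ?nnegrE ?addr_ge0 ?divr_ge0// ?(ltW h0)//.
  rewrite lerD// ?ler1n// ler_pdivlMr//; apply: (le_trans k1).
  exact: ler_norm.
(* To the left, both [t + k h] and [t + (k - 1) h] must lie in [[a, a + 2h]]; the two extra steps
   account for the constant 3 in the statement. *)
have [k [k1 k2]] : exists k : nat, k%:R - 2 <= (a - t) / h /\ (a - t) / h < k%:R - 1.
  have y0 : 0 <= (a - t) / h by rewrite divr_ge0 ?subr_ge0 ?ltW.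
  have /andP[k1 k2] := truncn_itv y0.
  exists (Num.truncn ((a - t) / h)).+2; rewrite -natr1 in k2.
  rewrite -(natr1 (_.+1)) -natr1; split; lra.
have k3 := k1; rewrite ler_pdivlMr// in k1; rewrite ltr_pdivrMr// in k2.
pose g i := f (t + k%:R * h - i%:R * h).
have -> : f t = g k by rewrite /g addrK.
apply: (@le_trans _ _ (W * (1 + k%:R) ^+ 2)).
  apply: second_difference_growth.
  - by rewrite /g mul0r subr0; apply: fW; apply/andP; split; lra.
  - by rewrite /g mul1r; apply: fW; apply/andP; split; lra.
  move=> i ik; rewrite /g -(natr1 i.+1) -(natr1 i).
  set x := t + k%:R * h - (i%:R + 1 + 1) * h.
  have -> : t + k%:R * h - i%:R * h = x + 2 * h by rewrite /x; ring.
  have -> : t + k%:R * h - (i%:R + 1) * h = x + h by rewrite /x; ring.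
  have ik' : (i%:R + 2) * h <= k%:R * h :> R.
    by rewrite ler_pM2r// -[2]/(2%:R) -natrD ler_nat addn2.
  have i0 : 0 <= i%:R * h by rewrite mulr_ge0// ltW.
  have -> : f x - 2 * f (x + h) + f (x + 2 * h) = f (x + 2 * h) - 2 * f (x + h) + f x by ring.
  by apply: H'; rewrite /x; [apply/andP; split|..]; lra.
apply: ler_wpM2l => //; apply: lerXn2r; rewrite ?nnegrE ?addr_ge0 ?divr_ge0 ?(ltW h0)//.
by rewrite ltr0_norm ?subr_lt0// opprB; lra.
Qed.

(** * The estimate for positive functionals *)

Section moduli.
Context (R : realType) (phi : R -> R) (M : R).
Hypothesis phiM : forall t, 0 <= t <= 1 -> `|phi t| <= M.

(** A supremum bounds the members of its set only when the set is bounded above; the bound [M] on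
    [phi] ensures this. *)
Lemma second_difference_le_omega2 (lambda u v : R) :
  0 <= v <= lambda -> 0 <= u -> u + 2 * v <= 1 ->
  `|phi (u + 2 * v) - 2 * phi (u + v) + phi u| <= omega2 phi lambda.
Proof.
move=> /andP[v0 vl] u0 uv.
have ub : has_ubound [set y | exists u h : R, [/\ 0 <= h <= lambda, 0 <= u <= 1,
    0 <= u + 2 * h <= 1 & y = `|phi (u + 2 * h) - 2 * phi (u + h) + phi u|]].
  exists (M + 2 * M + M) => _ [x [h [/andP[h0 _] /andP[x0 x1] xh ->]]].
  have xh' : 0 <= x + h <= 1 by case/andP: xh => ? ?; apply/andP; split; lra.
  rewrite (le_trans (ler_normD _ _))// lerD ?phiM ?x0//.
  rewrite (le_trans (ler_normB _ _))// lerD ?phiM// normrM ger0_norm//.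
  by rewrite ler_wpM2l// phiM.
rewrite /omega2; apply: ub_le_sup => //=; exists u, v; split=> //.
- by rewrite v0.
- by apply/andP; split; lra.
- by apply/andP; split; lra.
Qed.

Lemma omega2_ge0 (lambda : R) : 0 <= lambda -> 0 <= omega2 phi lambda.
Proof.
move=> l0; have := @second_difference_le_omega2 lambda 0 0.
rewrite lexx l0 mulr0 !addr0 ler01 => /(_ isT isT isT).
exact: le_trans.
Qed.

Lemma difference_le_omega (x y : R) : 0 <= x <= 1 -> 0 <= y <= 1 ->
  `|phi x - phi y| <= omega phi `|x - y|.
Proof.
wlog xy : x y / y <= x => [hw x01 y01|/[dup] x01 /andP[x0 x1] /[dup] y01 /andP[y0 y1]].
  have [yx|xy] := leP y x; first exact: hw.
  by rewrite distrC [`|x - y|]distrC; apply: hw => //; exact: ltW.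
have ub : has_ubound [set d | exists u v : R, [/\ 0 <= v <= `|x - y|, 0 <= u <= 1,
    0 <= u + v <= 1 & d = `|phi (u + v) - phi u|]].
  exists (M + M) => _ [u [v [_ u01 uv ->]]].
  by rewrite (le_trans (ler_normB _ _))// lerD ?phiM.
rewrite /omega; apply: ub_le_sup => //=; exists y, (x - y); rewrite subrKC.
by split=> //; rewrite subr_ge0 xy ler_norm.
Qed.

End moduli.

Section positive_functional.
Context (R : realType) (E : (R -> R) -> R).
Hypothesis ED : forall f g, bounded_measurable01 f -> bounded_measurable01 g ->
  E (fun t => f t + g t) = E f + E g.
Hypothesis EZ : forall c f, bounded_measurable01 f ->
  E (fun t => c * f t) = c * E f.
Hypothesis le_E : forall f g, bounded_measurable01 f -> bounded_measurable01 g ->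
  (forall t : R, 0 <= t <= 1 -> f t <= g t) -> E f <= E g.
Hypothesis Ecst : forall c, E (fun=> c) = c.

Lemma bounded_measurable01D (f g : R -> R) : bounded_measurable01 f ->
  bounded_measurable01 g -> bounded_measurable01 (fun t => f t + g t).
Proof.
move=> [mf [M fM]] [mg [N gN]]; split; first exact: measurable_funD.
by exists (M + N) => t t01; rewrite (le_trans (ler_normD _ _))// lerD ?fM ?gN.
Qed.

Lemma bounded_measurable01M (f g : R -> R) : bounded_measurable01 f ->
  bounded_measurable01 g -> bounded_measurable01 (fun t => f t * g t).
Proof.
move=> [mf [M fM]] [mg [N gN]]; split; first exact: measurable_funM.
by exists (M * N) => t t01; rewrite normrM ler_pM ?fM ?gN.
Qed.

Lemma bounded_measurable01Z (c : R) (f : R -> R) : bounded_measurable01 f ->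
  bounded_measurable01 (fun t => c * f t).
Proof. by apply: bounded_measurable01M; exact: bounded_measurable01_cst. Qed.

Lemma bounded_measurable01_id : bounded_measurable01 (fun t : R => t).
Proof.
split; first exact: measurable_id.
by exists 1 => t /andP[t0 t1]; rewrite ger0_norm.
Qed.

Lemma ler_norm_E f g : bounded_measurable01 f -> bounded_measurable01 g ->
  (forall t, 0 <= t <= 1 -> `|f t| <= g t) -> `|E f| <= E g.
Proof.
move=> bf bg fg; rewrite ler_norml; apply/andP; split; last first.
  by apply: le_E => // t t01; rewrite (le_trans (ler_norm _))// fg.
rewrite -mulN1r -EZ//; apply: le_E => //; first exact: bounded_measurable01Z.
by move=> t t01; rewrite mulN1r; have := fg _ t01; rewrite ler_norml => /andP[].
Qed.

Variables (phi : R -> R) (z : R).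
Hypotheses (bphi : bounded_measurable01 phi) (z01 : 0 <= z <= 1).
Let zeta := E (fun t => t - z).
Let varphi := E (fun t => (t - z) ^+ 2).
Let lambda := 1 / 2 * Num.sqrt (varphi + zeta ^+ 2).

Let bid := bounded_measurable01_id.
Let bcst := bounded_measurable01_cst.

Let bBz : bounded_measurable01 (fun t : R => t - z).
Proof. exact: bounded_measurable01D. Qed.

Let bBz2 : bounded_measurable01 (fun t : R => (t - z) ^+ 2).
Proof. exact: (bounded_measurable01M bBz bBz). Qed.

Let dist_z (t : R) : 0 <= t <= 1 -> `|t - z| <= 1.
Proof. by move=> /andP[? ?]; case/andP: z01 => ? ?; rewrite ler_norml; apply/andP; split; lra. Qed.

Let zetaE : zeta = E (fun t => t) - z.
Proof. by rewrite /zeta ED// Ecst. Qed.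

Let norm_zeta : `|zeta| <= 1.
Proof. by rewrite -[leRHS](Ecst 1); apply: ler_norm_E. Qed.

Let varphi_ge0 : 0 <= varphi.
Proof. by rewrite -[leLHS](Ecst 0); apply: le_E => // t _; exact: sqr_ge0. Qed.

Let varphi_le1 : varphi <= 1.
Proof.
rewrite -[leRHS](Ecst 1); apply: le_E => // t /dist_z tz.
by rewrite -real_normK ?num_real// exprn_ile1.
Qed.

(** The mean is [E] of the identity, squeezed between the constants 0 and 1; hence [phi] may be
    evaluated there. *)
Let mean01 : 0 <= z + zeta <= 1.
Proof.
rewrite zetaE subrKC; apply/andP; split.
  by rewrite -[leLHS](Ecst 0); apply: le_E => // t /andP[].
by rewrite -[leRHS](Ecst 1); apply: le_E => // t /andP[].
Qed.

Let second_moment_ge0 : 0 <= varphi + zeta ^+ 2.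
Proof. by rewrite addr_ge0 ?sqr_ge0. Qed.

Let lambda2 : lambda ^+ 2 = (varphi + zeta ^+ 2) / 4.
Proof. by rewrite /lambda exprMn sqr_sqrtr//; field. Qed.

Let lambda_ge0 : 0 <= lambda.
Proof. by rewrite mulr_ge0. Qed.

Let lambda_le1 : lambda <= 1.
Proof.
rewrite -(@ler_pXn2r _ 2) ?nnegrE// lambda2 expr1n.
have : zeta ^+ 2 <= 1 by rewrite -real_normK ?num_real// exprn_ile1.
by have := varphi_le1; lra.
Qed.

(** Positivity of [lambda] provides a nonzero step [h]. The constant is 306, from [E f], plus 25,
    from [f mu]. *)
Lemma functional_estimate_gt0 : 0 < lambda ->
  `|E phi - phi (z + zeta)| <= 331 * omega2 phi lambda.
Proof.
move=> l0; have [_ [M phiM]] := bphi.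
set W := omega2 phi lambda; pose mu := z + zeta; pose h := lambda / 4.
have h0 : 0 < h by rewrite divr_gt0.
have h1 : 4 * h <= 1 by rewrite /h; have := lambda_le1; lra.
have W0 : 0 <= W by exact: (@omega2_ge0 _ _ M).
have [mu0 mu1] : 0 <= mu /\ mu <= 1 by case/andP: mean01.
(* The interval starts at the mean unless it would leave [0, 1]; then it is pushed back to end at 1
   and still contains the mean. *)
pose a := Num.min mu (1 - 2 * h).
have [a0 ah amu] : [/\ 0 <= a, a + 2 * h <= 1 & `|mu - a| <= 2 * h].
  rewrite /a; have [?|?] := leP mu (1 - 2 * h).
    by split; rewrite ?subrr ?normr0; lra.
  by split; rewrite ?ger0_norm; lra.
have Hdiff u v : 0 <= v <= h -> 0 <= u -> u + 2 * v <= 1 ->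
    `|phi (u + 2 * v) - 2 * phi (u + v) + phi u| <= W.
  move=> /andP[v0 vh]; apply: (second_difference_le_omega2 phiM).
  by rewrite v0 (le_trans vh)// /h ler_piMr ?(ltW l0)//; lra.
have [c [d Hcd]] := affine_approximation h0 a0 ah phiM Hdiff.
pose f t := phi t - (c + d * t).
have bd : bounded_measurable01 (fun t => d * t) by exact: bounded_measurable01Z.
have bl : bounded_measurable01 (fun t => c + d * t) by exact: bounded_measurable01D.
have bf : bounded_measurable01 f.
  have -> : f = fun t => phi t + (-1) * (c + d * t).
    by apply/funext => t; rewrite /f mulN1r.
  exact: (bounded_measurable01D bphi (bounded_measurable01Z (-1) bl)).
have Ef : E phi - phi mu = E f - f mu.
  have -> : E phi = E (fun t => f t + (c + d * t)).
    by congr E; apply/funext => t; rewrite /f subrK.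
  rewrite ED// (ED (bcst c) bd) Ecst EZ// /f /mu zetaE subrKC; ring.
(* With y = |t - mu| / h, the bound becomes (3 + |t - a| / h)^2 <= (5 + y)^2 <= 50 + 2 y^2, and y^2
   <= 2 ((t - z)^2 + zeta^2) / h^2. *)
pose K := W * (50 + 4 * (zeta / h) ^+ 2); pose L := W * (4 / h ^+ 2).
have bK : bounded_measurable01 (fun t => L * (t - z) ^+ 2) by exact: bounded_measurable01Z.
have fK t : 0 <= t <= 1 -> `|f t| <= K + L * (t - z) ^+ 2.
  move=> t01; apply: le_trans (Hcd _ t01) _.
  have -> : K + L * (t - z) ^+ 2 = W * (50 + 4 * ((t - z) ^+ 2 + zeta ^+ 2) / h ^+ 2).
    by rewrite /K /L; field; rewrite gt_eqF.
  apply: ler_wpM2l => //; set y := `|t - mu| / h.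
  have y0 : 0 <= y by rewrite divr_ge0// ltW.
  have ty : `|t - a| / h <= y + 2.
    rewrite ler_pdivrMr// mulrDl divfK ?gt_eqF//.
    have -> : t - a = (t - mu) + (mu - a) by ring.
    by rewrite (le_trans (ler_normD _ _))// lerD2l.
  have y2 : y ^+ 2 <= 2 * ((t - z) ^+ 2 + zeta ^+ 2) / h ^+ 2.
    rewrite /y expr_div_n real_normK ?num_real// ler_pM2r ?invr_gt0 ?exprn_gt0//.
    rewrite -subr_ge0 /mu.
    have -> : 2 * ((t - z) ^+ 2 + zeta ^+ 2) - (t - (z + zeta)) ^+ 2
      = (t - z + zeta) ^+ 2 by ring.
    exact: sqr_ge0.
  apply: (@le_trans _ _ ((5 + y) ^+ 2)).
    apply: lerXn2r; rewrite ?nnegrE ?addr_ge0 ?divr_ge0 ?(ltW h0)//.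
    by move: ty; lra.
  have : 0 <= (5 - y) ^+ 2 by exact: sqr_ge0.
  have -> : 4 * ((t - z) ^+ 2 + zeta ^+ 2) / h ^+ 2
    = 2 * (2 * ((t - z) ^+ 2 + zeta ^+ 2) / h ^+ 2) by ring.
  by move: y2; set q := (2 * _ / _); nra.
(* Here 306 = 50 + 256, since 4 (varphi + zeta^2) = 16 lambda^2 and lambda = 4 h. *)
have EfK : `|E f| <= 306 * W.
  apply: le_trans (ler_norm_E bf _ fK) _; first exact: bounded_measurable01D.
  rewrite ED// Ecst EZ// -/varphi /K /L.
  have -> : W * (50 + 4 * (zeta / h) ^+ 2) + W * (4 / h ^+ 2) * varphi
     = W * (50 + 16 * ((varphi + zeta ^+ 2) / 4) / h ^+ 2) by field; rewrite gt_eqF.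
  rewrite -lambda2.
  have -> : 16 * lambda ^+ 2 / h ^+ 2 = 256 by rewrite /h; field; rewrite gt_eqF.
  by rewrite mulrC ler_wpM2r//; lra.
(* As |mu - a| <= 2 h, the factor is at most (3 + 2)^2. *)
have fmu : `|f mu| <= 25 * W.
  have mu01 : 0 <= mu <= 1 by exact: mean01.
  apply: le_trans (Hcd _ mu01) _; rewrite mulrC ler_wpM2r//.
  have : `|mu - a| / h <= 2 by rewrite ler_pdivrMr.
  have : 0 <= `|mu - a| / h by rewrite divr_ge0// ltW.
  by set y := _ / _; nra.
rewrite Ef (le_trans (ler_normB _ _))//.
have -> : 331 * W = 306 * W + 25 * W by ring.
exact: lerD.
Qed.

Hypothesis phi_cont : forall e : R, 0 < e -> exists2 d : R, 0 < d &
  forall t : R, 0 <= t <= 1 -> `|t - z| < d -> `|phi t - phi z| <= e.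

(** The second moment about [z] vanishes, so [E] does not see multiples of (t - z)^2. By continuity
    at [z], such a multiple plus [e] dominates |phi t - phi z| for every [e > 0]. *)
Lemma functional_estimate_eq0 : lambda = 0 -> E phi = phi z.
Proof.
move=> l0; have varphi0 : varphi = 0.
  have := lambda2; rewrite l0 expr0n/= => /eqP.
  rewrite eq_sym mulf_eq0 invr_eq0 [4 == 0]pnatr_eq0 orbF paddr_eq0 ?sqr_ge0//.
  by case/andP => /eqP.
apply/eqP; rewrite -subr_eq0 -normr_le0; apply/ler_addgt0Pr => e e0.
rewrite add0r.
have [d d0 Hd] := phi_cont e0; have [_ [M phiM]] := bphi.
have EB : E phi - phi z = E (fun t => phi t + - phi z) by rewrite ED// Ecst.
(* Chosen so that [L * (t - z) ^+ 2] is at least [2 * M] once [t] is at distance at least [d] from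
   [z]. *)
pose L := 2 * M / d ^+ 2.
have bL : bounded_measurable01 (fun t => L * (t - z) ^+ 2) by exact: bounded_measurable01Z.
have M0 : 0 <= M by apply: le_trans (phiM _ z01).
have -> : e = E (fun t => e + L * (t - z) ^+ 2).
  by rewrite ED// Ecst EZ// -/varphi varphi0 mulr0 addr0.
rewrite EB; apply: ler_norm_E; [exact: bounded_measurable01D..|].
move=> t t01; have [td|dt] := ltP `|t - z| d.
  have L0 : 0 <= L by apply: divr_ge0; rewrite ?sqr_ge0 ?mulr_ge0.
  by apply: (le_trans (Hd _ t01 td)); rewrite lerDl mulr_ge0 ?sqr_ge0.
rewrite (@le_trans _ _ (2 * M))//.
  by rewrite (le_trans (ler_normB _ _))// mulr_natl mulr2n lerD ?phiM.
rewrite -[leLHS]add0r lerD ?(ltW e0)// /L mulrAC ler_pdivlMr ?exprn_gt0//.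
rewrite ler_wpM2l ?mulr_ge0// -[leRHS]real_normK ?num_real//.
by rewrite lerXn2r ?nnegrE// ltW.
Qed.

Lemma functional_estimate :
  `|E phi - phi z| <= 331 * omega2 phi lambda + omega phi `|zeta|.
Proof.
have [_ [M phiM]] := bphi.
have zz : z + zeta - z = zeta by rewrite addrAC subrr add0r.
have om : `|phi (z + zeta) - phi z| <= omega phi `|zeta|.
  by rewrite -{2}zz; exact: (difference_le_omega phiM).
have [l0|l0] := eqVneq lambda 0; last first.
  rewrite -(subrKA (phi (z + zeta))) (le_trans (ler_normD _ _))// lerD//.
  by apply: functional_estimate_gt0; rewrite lt0r l0 lambda_ge0.
rewrite functional_estimate_eq0// subrr normr0; apply: addr_ge0.
  by apply: mulr_ge0; [exact: ler0n|exact: (@omega2_ge0 _ _ M)].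
exact: le_trans om.
Qed.

End positive_functional.

(** * Continuous functions on [0, 1] and the estimate for the operator *)

Lemma within_continuous_bounded_measurable01 (R : realType) (phi : R -> R) :
  {within `[0, 1], continuous phi} -> bounded_measurable01 phi.
Proof.
move=> cphi; split; first exact: subspace_continuous_measurable_fun.
have [a _ ha] := EVT_max ler01 cphi.
have [b _ hb] := EVT_min ler01 cphi.
exists (`|phi a| + `|phi b|) => t t01; rewrite ler_norml; apply/andP; split.
  apply: le_trans (hb t _); last by rewrite in_itv.
  by rewrite lerNl (le_trans (ler_norm _))// normrN lerDr.
apply: le_trans (ha t _) _; first by rewrite in_itv.
by rewrite (le_trans (ler_norm _))// lerDl.
Qed.

Lemma within_continuous_dist_le (R : realType) (phi : R -> R) (z : R) :
  {within `[0, 1], continuous phi} -> 0 <= z <= 1 ->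
  forall e : R, 0 < e -> exists2 d : R, 0 < d &
    forall t : R, 0 <= t <= 1 -> `|t - z| < d -> `|phi t - phi z| <= e.
Proof.
move=> /subspace_continuousP/(_ z) cphi z01 e e0.
have /cvgrPdist_le/(_ e e0) : phi x @[x --> within `[0, 1] (nbhs z)] --> phi z.
  by apply: cphi; rewrite /= in_itv.
rewrite near_withinE => -[d /= d0 Hd]; exists d => // t t01 tz.
by rewrite distrC; apply: Hd; rewrite /= ?in_itv// distrC.
Qed.

Theorem theorem5 (R : realType) :
  exists C : R, 0 < C /\
    forall (m : nat) (eta gamma alpha : R) (s : nat) (phi : R -> R) (z : R),
      (0 < m)%N -> 0 < eta -> 0 < gamma -> 0 <= alpha <= 1 ->
      {within `[0, 1], continuous phi} -> 0 <= z <= 1 ->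
      let zeta := central_moment 1 m eta gamma alpha s z in
      let varphi := central_moment 2 m eta gamma alpha s z in
      zeta = 1 / (m%:R + 1) *
               (Gamma (eta + 1) * Gamma (gamma + 1) / Gamma (eta + gamma + 1))
             - z / (m%:R + 1)
      /\ `|frac_op m eta gamma alpha s phi z - phi z|
         <= C * omega2 phi (1 / 2 * Num.sqrt (varphi + zeta ^+ 2))
            + omega phi `|zeta|.
Proof.
exists 331; split; first by rewrite ltr0n.
move=> m eta gamma alpha s phi z _ eta0 gamma0 alpha01 cphi z01 zeta varphi.
pose E f := frac_op m eta gamma alpha s f z.
have ED := @frac_opD R m s eta gamma alpha z eta0 gamma0.
have EZ := @frac_opZ R m s eta gamma alpha z eta0 gamma0.
have le_E := @le_frac_op R m s eta gamma alpha z eta0 gamma0 alpha01 z01.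
have Ecst := @frac_op_cst R m s eta gamma alpha z eta0.
have bid := bounded_measurable01_id R.
have zetaE : zeta = E (fun t => t - z).
  by rewrite /zeta /central_moment; congr frac_op; apply/funext => t; rewrite expr1.
split.
  rewrite zetaE /E ED//; last exact: bounded_measurable01_cst.
  rewrite Ecst (frac_op_id m s alpha z eta0 gamma0).
  (* With the Gamma quotient made opaque, only [m + 1] remains as a denominator for [field]. *)
  move: (_ * _ / Gamma _) => G.
  by field; rewrite gt_eqF// ltr_wpDl.
rewrite zetaE; apply: (@functional_estimate R E) => //.
- exact: within_continuous_bounded_measurable01.
- exact: within_continuous_dist_le.
Qed.
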